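(* Let $(p_n)_{n\ge1}$ and $(q_n)_{n\ge1}$ be real sequences with $0<q_n<p_n\le 1$ for all $n$ and $\lim_{n\to\infty}p_n=1$, $\lim_{n\to\infty}q_n=1$. Let $\omega$ be a modulus of continuity and $H_\omega$ the associated function space. Then for each $n\ge1$, each $x\ge 0$ and every $f\in H_\omega$, $$\left|L_n^{p_n,q_n}(f;x)-f(x)\right|\le 2\,\widetilde{\omega}\left(f;\sqrt{\delta_n(x)}\right),$$ where $$\delta_n(x)=\frac{x^2}{(1+x)^2}\left(\frac{p_nq_n^2[n]_{p_n,q_n}[n-1]_{p_n,q_n}}{[n+1]_{p_n,q_n}^2}\,\frac{1+x}{p_n+q_nx}-2\,\frac{p_n[n]_{p_n,q_n}}{[n+1]_{p_n,q_n}}+1\right)+\frac{p_n^{n+1}[n]_{p_n,q_n}}{[n+1]_{p_n,q_n}^2}\,\frac{x}{1+x}.$$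
   Context: $\mathbb{R}_+=[0,\infty)$. A modulus of continuity is a function $\omega$ on $\mathbb{R}_+$ such that: $\omega$ is non-negative and increasing on $\mathbb{R}_+$; $\omega(\delta_1+\delta_2)\le\omega(\delta_1)+\omega(\delta_2)$; and $\lim_{\delta\to0}\omega(\delta)=0$. $H_\omega$ is the space of all real-valued functions $f$ on $\mathbb{R}_+$ satisfying $|f(x)-f(y)|\le\omega\left(\left|\frac{x}{1+x}-\frac{y}{1+y}\right|\right)$ for all $x,y\in\mathbb{R}_+$. For $f\in H_\omega$ and $\delta\ge0$, $$\widetilde{\omega}(f;\delta)=\sup\left\{|f(t)-f(x)|:\ x,t\ge0,\ \left|\tfrac{t}{1+t}-\tfrac{x}{1+x}\right|\le\delta\right\}.$$ For $0<q<p\le1$ and integers $n\ge 0$, the $(p,q)$-integers are $[n]_{p,q}=\frac{p^n-q^n}{p-q}$; $[n]_{p,q}!=[1]_{p,q}[2]_{p,q}\cdots[n]_{p,q}$ with $[0]_{p,q}!=1$; $\binom{n}{k}_{p,q}=\frac{[n]_{p,q}!}{[k]_{p,q}!\,[n-k]_{p,q}!}$ for $0\le k\le n$. For $n\ge1$, $x\ge 0$ and $f:\mathbb{R}_+\to\mathbb{R}$, the $(p,q)$-Bleimann–Butzer–Hahn operator is $$L_n^{p,q}(f;x)=\frac{1}{\ell_n^{p,q}(x)}\sum_{k=0}^n f\left(\frac{p^{n-k+1}[k]_{p,q}}{[n-k+1]_{p,q}\,q^k}\right)p^{\frac{(n-k)(n-k-1)}{2}}q^{\frac{k(k-1)}{2}}\binom{n}{k}_{p,q}x^k,\qquad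 \ell_n^{p,q}(x)=\prod_{s=0}^{n-1}(p^s+q^sx).$$ *)

(* Defs.v *)
From HB Require Import structures.
From mathcomp Require Import all_boot all_order all_algebra.
From mathcomp Require Import all_classical all_reals all_analysis.

Set Implicit Arguments.
Unset Strict Implicit.
Unset Printing Implicit Defensive.

Import Order.TTheory GRing.Theory Num.Theory.
Import numFieldNormedType.Exports.

Local Open Scope classical_set_scope.
Local Open Scope ring_scope.

(* Functions on [0, +oo[ are total functions R -> R of which only the values
   at nonnegative arguments are constrained or used. *)

Section Moduli.
Context {R : realType}.
Implicit Types (omega f : R -> R) (delta x t : R).

(* "Increasing" is meant in the weak sense. *)
Record modulus_of_continuity omega : Prop := ModulusOfContinuity {
  modulus_ge0 : forall delta, 0 <= delta -> 0 <= omega delta;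
  modulus_homo : forall delta1 delta2,
    0 <= delta1 -> delta1 <= delta2 -> omega delta1 <= omega delta2;
  modulus_subadd : forall delta1 delta2, 0 <= delta1 -> 0 <= delta2 ->
    omega (delta1 + delta2) <= omega delta1 + omega delta2;
  modulus_cvg0 : omega delta @[delta --> 0^'+] --> (0 : R) }.

Definition H_space omega : set (R -> R) :=
  [set f | forall x y, 0 <= x -> 0 <= y ->
    `|f x - f y| <= omega `|x / (1 + x) - y / (1 + y)|].

(* The real supremum [sup] is the true one here: for delta >= 0 and f in
   H_space omega the set is nonempty and bounded above by omega delta. *)
Definition omega_tilde f delta : R :=
  sup [set r | exists t x, [/\ 0 <= t, 0 <= x,
    `|t / (1 + t) - x / (1 + x)| <= delta & r = `|f t - f x|]].

End Moduli.

Section PQBleimannButzerHahn.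
Context {R : realType}.
Implicit Types (p q x : R) (n k : nat) (f : R -> R).

Definition pq_int p q n : R := (p ^+ n - q ^+ n) / (p - q).

Definition pq_fact p q n : R := \prod_(1 <= i < n.+1) pq_int p q i.

Definition pq_binom p q n k : R :=
  pq_fact p q n / (pq_fact p q k * pq_fact p q (n - k)).

Definition pq_ell p q n x : R := \prod_(0 <= s < n) (p ^+ s + q ^+ s * x).

Definition pq_node p q n k : R :=
  p ^+ (n - k + 1) * pq_int p q k / (pq_int p q (n - k + 1) * q ^+ k).

(* The natural-number divisions by 2 are exact; at k = n and k = 0 the
   truncated predecessor is harmless, its cofactor being 0. *)
Definition pq_BBH p q n f x : R :=
  (pq_ell p q n x)^-1 *
  \sum_(0 <= k < n.+1)
    f (pq_node p q n k) *
    p ^+ ((n - k) * (n - k - 1) %/ 2) * q ^+ (k * (k - 1) %/ 2) *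
    pq_binom p q n k * x ^+ k.

(* Meant for n >= 1, so that n - 1 is not truncated. *)
Definition pq_delta p q n x : R :=
  x ^+ 2 / (1 + x) ^+ 2 *
    (p * q ^+ 2 * pq_int p q n * pq_int p q (n - 1) / pq_int p q (n + 1) ^+ 2 *
       ((1 + x) / (p + q * x))
     - 2 * (p * pq_int p q n / pq_int p q (n + 1)) + 1)
  + p ^+ (n + 1) * pq_int p q n / pq_int p q (n + 1) ^+ 2 * (x / (1 + x)).

End PQBleimannButzerHahn.

(* Main.v *)
Require Import Defs.
From HB Require Import structures.
From mathcomp Require Import all_boot all_order all_algebra.
From mathcomp Require Import all_classical all_reals all_analysis.
From mathcomp Require Import ring lra.

Set Implicit Arguments.
Unset Strict Implicit.
Unset Printing Implicit Defensive.

Import Order.TTheory GRing.Theory Num.Theory.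
Import numFieldNormedType.Exports.

Local Open Scope classical_set_scope.
Local Open Scope ring_scope.

(** Write phi(t) = t / (1 + t), an increasing bijection from [0, +oo[ onto
    [0, 1[, and t_k for the nodes. The operator is an average: by the Gauss
    binomial theorem [gauss_binomial] its coefficients are nonnegative weights
    w_k of sum 1. Since [n+1] = q^k [n-k+1] + p^(n-k+1) [k], the nodes satisfy
    phi(t_k) = p^(n-k+1) [k] / [n+1] ([node_compress]), so that the mean and
    the second moment of the phi(t_k) can be summed: the identity
    [k] binom(n, k) = [n] binom(n-1, k-1) ([gauss_absorption]) lowers n and
    rescales the two variables of the homogeneous Gauss polynomial, once for
    the first moment and twice for the second. The resulting mean square
    distance from phi(t_k) to phi(x) is delta_n(x) with a factor p^2 q^2 where
    delta_n(x) has p q^2; as p <= 1 it is at most delta_n(x)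
    ([compressed_variance_le]).

    The rest is the usual Chebyshev-type estimate. Any two points at
    phi-distance at most m delta are joined by m steps of phi-length at most
    delta, whence |f(t) - f(x)| <= (1 + u^2 / delta^2) omega~(f; delta) for
    u = phi(t) - phi(x) ([omega_tilde_quadratic]). Averaging this bound with
    delta^2 = delta_n(x) gives the factor 1 + 1 = 2 ([weighted_mean_le]). *)

(** * The compression t / (1 + t) and the modulus omega~ *)

Section Compression.
Context {R : realType}.
Implicit Types (omega f : R -> R) (d x t : R).

Definition compress t : R := t / (1 + t).

Lemma compress_ge0 t : 0 <= t -> 0 <= compress t.
Proof. by move=> t0; rewrite divr_ge0 // addr_ge0. Qed.

Lemma compress_lt1 t : 0 <= t -> compress t < 1.
Proof.
by move=> t0; rewrite /compress ltr_pdivrMr ?mul1r ?ltrDr // ltr_pwDl.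
Qed.

Lemma compress_onto z : 0 <= z -> z < 1 -> exists2 t, 0 <= t & compress t = z.
Proof.
move=> z0 z1; have z1' : 1 - z != 0 by rewrite subr_eq0 eq_sym lt_eqF.
exists (z / (1 - z)); first by rewrite divr_ge0 // subr_ge0 ltW.
rewrite /compress; have -> : 1 + z / (1 - z) = (1 - z)^-1 by field.
by rewrite invrK mulfVK.
Qed.

Lemma compress_inj x t : 0 <= x -> 0 <= t -> compress x = compress t -> x = t.
Proof.
move=> x0 t0 /eqP; rewrite /compress eqr_div; try by rewrite gt_eqF ?ltr_pwDl.
by move=> /eqP e; lra.
Qed.

Lemma omega_tilde_ub omega f d x t :
  modulus_of_continuity omega -> H_space omega f ->
  0 <= x -> 0 <= t -> `|compress t - compress x| <= d ->
  `|f t - f x| <= omega_tilde f d.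
Proof.
move=> om hf x0 t0 dtx; apply: sup_upper_bound; last by exists t, x.
split; first by exists `|f t - f x|, t, x.
exists (omega d) => _ [t' [x' [t'0 x'0 dtx' ->]]].
exact: le_trans (hf _ _ t'0 x'0) (modulus_homo om (normr_ge0 _) dtx').
Qed.

(** The range [0, 1[ of [compress] is convex, so a jump of phi-length
    (m + 1) d can be cut into a step of length d and a jump of length m d. *)
Lemma omega_tilde_chain omega f d x t m :
  modulus_of_continuity omega -> H_space omega f ->
  0 <= x -> 0 <= t -> `|compress t - compress x| <= m.+1%:R * d ->
  `|f t - f x| <= m.+1%:R * omega_tilde f d.
Proof.
move=> om hf x0; elim: m t => [|m IH] t t0.
  by rewrite !mul1r; exact: omega_tilde_ub om hf x0 t0.
set u := compress t - compress x => hu.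
have m0 : 0 < m.+2%:R :> R by rewrite ltr0n.
set r : R := m.+2%:R^-1; have r0 : 0 <= r by rewrite invr_ge0 ltW.
have rm : r * m.+2%:R = 1 by rewrite mulVf // gt_eqF.
have m1 : m.+2%:R = m.+1%:R + 1 :> R by rewrite -natr1.
have r1 : 0 <= 1 - r by rewrite subr_ge0 /r invf_le1 // ler1n.
clearbody r.
(* s divides the phi-segment from x to t in the ratio m + 1 : 1. *)
have [||s s0 hs] := @compress_onto (r * compress x + (1 - r) * compress t).
- by rewrite addr_ge0 // mulr_ge0 // compress_ge0.
- have [xt|/ltW tx] := leP (compress x) (compress t).
    apply: le_lt_trans (compress_lt1 t0); rewrite -subr_ge0.
    rewrite (_ : _ - _ = r * (compress t - compress x)); last by ring.
    by rewrite mulr_ge0 // subr_ge0.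
  apply: le_lt_trans (compress_lt1 x0); rewrite -subr_ge0.
  rewrite (_ : _ - _ = (1 - r) * (compress x - compress t)); last by ring.
  by rewrite mulr_ge0 // subr_ge0.
have e1 : compress t - compress s = r * u by rewrite hs /u; ring.
have e2 : compress s - compress x = r * m.+1%:R * u.
  have -> : r * m.+1%:R = 1 - r.
    by apply/eqP; rewrite eq_sym subr_eq -[X in _ + X]mulr1 -mulrDr -m1 rm.
  by rewrite hs /u; ring.
have rd : r * (m.+2%:R * d) = d by rewrite mulrA rm mul1r.
have h1 : `|f t - f s| <= omega_tilde f d.
  apply: omega_tilde_ub om hf s0 t0 _; rewrite e1 normrM (ger0_norm r0) -rd.
  exact: ler_wpM2l.
have h2 : `|f s - f x| <= m.+1%:R * omega_tilde f d.
  apply: (IH s s0); rewrite e2 normrM ger0_norm ?mulr_ge0 // -rd.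
  by rewrite mulrCA mulrA ler_wpM2l // mulr_ge0.
rewrite m1 mulrDl mul1r (le_trans (ler_distD (f s) _ _)) // addrC.
exact: lerD.
Qed.

Lemma omega_tilde_ge0 omega f d :
  modulus_of_continuity omega -> H_space omega f -> 0 <= d ->
  0 <= omega_tilde f d.
Proof.
move=> om hf d0; rewrite -(normr0 R) -(subrr (f 0)).
by apply: omega_tilde_ub om hf _ _ _ => //; rewrite subrr normr0.
Qed.

(** A quadratic bound, instead of the usual 1 + |u| / d, makes it possible to
    average against the second moment without the Cauchy-Schwarz inequality:
    for |u| > d the linear bound is the smaller one, and for |u| <= d a single
    step is enough. *)
Lemma omega_tilde_quadratic omega f d x t :
  modulus_of_continuity omega -> H_space omega f -> 0 < d ->
  0 <= x -> 0 <= t ->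
  `|f t - f x| <=
    (1 + (compress t - compress x) ^+ 2 / d ^+ 2) * omega_tilde f d.
Proof.
move=> om hf d0 x0 t0; set u := compress t - compress x.
have w0 := omega_tilde_ge0 om hf (ltW d0).
have [ud|du] := leP `|u| d.
  apply: le_trans (omega_tilde_ub om hf x0 t0 ud) _.
  rewrite -[leLHS]mul1r ler_wpM2r // lerDl divr_ge0 ?sqr_ge0 //.
rewrite -expr_div_n -real_normK ?num_real // normrM normfV (gtr0_norm d0).
set v := `|u| / d; have v1 : 1 < v by rewrite ltr_pdivlMr ?mul1r.
have v0 : 0 <= v by rewrite ltW // (lt_trans ltr01).
have /andP[mv vm] := truncn_itv v0.
apply: le_trans (omega_tilde_chain (d := d) (m := Num.truncn v) om hf x0 t0 _) _.
  by rewrite -ler_pdivrMr // ltW.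
rewrite ler_wpM2r // -natr1; nra.
Qed.

(** For D > 0 this is the weighted average of [omega_tilde_quadratic] with
    d^2 = D. If D = 0, only nodes equal to x carry weight. *)
Lemma weighted_mean_le omega f D x n (w t : 'I_n -> R) :
  modulus_of_continuity omega -> H_space omega f -> 0 <= x ->
  (forall k, 0 <= t k) -> (forall k, 0 <= w k) -> \sum_k w k = 1 ->
  \sum_k w k * (compress (t k) - compress x) ^+ 2 <= D ->
  `|\sum_k w k * f (t k) - f x| <= 2 * omega_tilde f (Num.sqrt D).
Proof.
move=> om hf x0 t0 w0 w1 wD.
have wu0 k : 0 <= w k * (compress (t k) - compress x) ^+ 2.
  by rewrite mulr_ge0 ?sqr_ge0.
have D0 : 0 <= D by apply: le_trans wD; exact: sumr_ge0.
have O0 := omega_tilde_ge0 om hf (sqrtr_ge0 D).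
have -> : \sum_k w k * f (t k) - f x = \sum_k w k * (f (t k) - f x).
  rewrite -[X in _ - X]mul1r -w1 mulr_suml -sumrB.
  by apply: eq_bigr => k _; rewrite mulrBr.
apply: le_trans (ler_norm_sum _ _ _) _.
have [D00|Dn0] := eqVneq D 0.
  rewrite big1 ?mulr_ge0 // => k _; apply/eqP.
  have /eqP : w k * (compress (t k) - compress x) ^+ 2 = 0.
    have wS : \sum_k w k * (compress (t k) - compress x) ^+ 2 = 0.
      by apply/eqP; rewrite eq_le sumr_ge0 // -{2}D00 wD.
    by have := psumr_eq0P (fun i _ => wu0 i) wS; apply.
  rewrite mulf_eq0 expf_eq0 /= subr_eq0 normr_eq0 mulf_eq0 => /orP[->//|/eqP e].
  by rewrite (compress_inj (t0 k) x0 e) subrr eqxx orbT.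
have d0 : 0 < Num.sqrt D by rewrite sqrtr_gt0 lt_neqAle eq_sym Dn0.
pose u k := compress (t k) - compress x.
set O := omega_tilde f (Num.sqrt D).
have -> : 2 * O = (1 + D / D) * O by rewrite divff.
apply: (@le_trans _ _ (\sum_k (w k + w k * u k ^+ 2 / D) * O)).
  apply: ler_sum => k _; rewrite normrM (ger0_norm (w0 k)).
  have := omega_tilde_quadratic om hf d0 x0 (t0 k); rewrite sqr_sqrtr //.
  move=> /(ler_wpM2l (w0 k)) /le_trans; apply.
  by rewrite mulrA mulrDr mulr1 mulrA.
rewrite -mulr_suml big_split /= w1 -mulr_suml.
by rewrite ler_wpM2r // lerD2l ler_wpM2r // invr_ge0.
Qed.

End Compression.

(** * Gauss polynomials for the (p, q)-integers *)

Section Gauss.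
Context {R : realType}.
Variables p q : R.
Hypotheses (q_gt0 : 0 < q) (q_lt_p : q < p).
Implicit Types (a b x : R) (n m k j : nat).

Local Notation "[ n ]" := (pq_int p q n) (at level 0, n at level 99).

Let p_gt0 : 0 < p := lt_trans q_gt0 q_lt_p.

Let p_sub_q_neq0 : p - q != 0.
Proof. by rewrite subr_eq0 gt_eqF. Qed.

Lemma pq_int0 : [0] = 0.
Proof. by rewrite /pq_int !expr0 subrr mul0r. Qed.

Lemma pq_intD m k : [m + k] = q ^+ k * [m] + p ^+ m * [k].
Proof. by rewrite /pq_int !exprD; field. Qed.

Lemma pq_intS n : [n.+1] = p ^+ n + q * [n].
Proof. by rewrite /pq_int !exprS; field. Qed.

Lemma pq_int_gt0 n : 0 < [n.+1].
Proof.
by apply: divr_gt0; rewrite subr_gt0 // ltr_pXn2r ?nnegrE ?ltW.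
Qed.

Lemma pq_int_ge0 n : 0 <= [n].
Proof. by case: n => [|n]; [rewrite pq_int0 | exact/ltW/pq_int_gt0]. Qed.

Lemma pq_fact0 : pq_fact p q 0 = 1.
Proof. by rewrite /pq_fact big_geq. Qed.

Lemma pq_factS n : pq_fact p q n.+1 = pq_fact p q n * [n.+1].
Proof. by rewrite /pq_fact big_nat_recr. Qed.

Lemma pq_fact_gt0 n : 0 < pq_fact p q n.
Proof.
by elim: n => [|n IH]; rewrite ?pq_fact0 // pq_factS mulr_gt0 // pq_int_gt0.
Qed.

Let pq_fact_neq0 n : pq_fact p q n != 0.
Proof. by rewrite gt_eqF // pq_fact_gt0. Qed.

Let pq_int_neq0 n : [n.+1] != 0.
Proof. by rewrite gt_eqF // pq_int_gt0. Qed.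

Lemma pq_binom0 n : pq_binom p q n 0 = 1.
Proof. by rewrite /pq_binom subn0 pq_fact0 mul1r divff. Qed.

Lemma pq_binomnn n : pq_binom p q n n = 1.
Proof. by rewrite /pq_binom subnn pq_fact0 mulr1 divff. Qed.

Lemma pq_binom_ge0 n k : 0 <= pq_binom p q n k.
Proof. by rewrite divr_ge0 ?mulr_ge0 // ltW // pq_fact_gt0. Qed.

Lemma pq_pascal n k : (k < n)%N ->
  pq_binom p q n.+1 k.+1 =
  q ^+ k.+1 * pq_binom p q n k.+1 + p ^+ (n - k) * pq_binom p q n k.
Proof.
move=> kn; rewrite /pq_binom subSS !pq_factS.
have e : (n - k = (n - k.+1).+1)%N by rewrite subnSK.
have -> : [n.+1] = q ^+ k.+1 * [n - k] + p ^+ (n - k) * [k.+1].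
  by rewrite -pq_intD addnS subnK // ltnW.
rewrite e pq_factS; field; by rewrite !pq_fact_neq0 !pq_int_neq0.
Qed.

Lemma pq_binom_absorption n k : (k <= n)%N ->
  [k.+1] * pq_binom p q n.+1 k.+1 = [n.+1] * pq_binom p q n k.
Proof.
move=> kn; rewrite /pq_binom subSS !pq_factS.
by field; rewrite !pq_fact_neq0 !pq_int_neq0.
Qed.

Definition gauss_coef n k : R :=
  p ^+ 'C(n - k, 2) * q ^+ 'C(k, 2) * pq_binom p q n k.

(** Two variables are kept because factors p^(n-k) and q^k in the k-th term
    are then the substitutions a -> a p and b -> b q, and shifting the product
    by one index is both of them at once. *)
Definition gauss_poly n a b : R := \prod_(s < n) (a * p ^+ s + b * q ^+ s).

Lemma gauss_coef_ge0 n k : 0 <= gauss_coef n k.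
Proof. by apply: mulr_ge0 (pq_binom_ge0 n k); rewrite mulr_ge0 ?exprn_ge0 ?ltW. Qed.

Lemma gauss_polyS n a b :
  gauss_poly n.+1 a b = (a + b) * gauss_poly n (a * p) (b * q).
Proof.
rewrite /gauss_poly big_ord_recl !expr0 !mulr1; congr (_ * _).
by apply: eq_bigr => s _; rewrite /= /bump /= !exprS !mulrA.
Qed.

Lemma gauss_poly_gt0 n a b : 0 < a -> 0 <= b -> 0 < gauss_poly n a b.
Proof.
move=> a0 b0; apply: prodr_gt0 => s _; apply: ltr_pwDl.
  by rewrite mulr_gt0 ?exprn_gt0.
by rewrite mulr_ge0 ?exprn_ge0 // ltW.
Qed.

Lemma gauss_binomial n a b :
  gauss_poly n a b = \sum_(k < n.+1) gauss_coef n k * a ^+ (n - k) * b ^+ k.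
Proof.
elim: n a b => [|n IH] a b.
  by rewrite /gauss_poly big_ord0 big_ord1 /gauss_coef pq_binom0 !expr0 !mulr1.
rewrite gauss_polyS IH mulrDl !mulr_sumr.
rewrite [X in X + _]big_ord_recl [X in _ + X]big_ord_recr /=.
rewrite [RHS]big_ord_recl [X in _ = _ + X]big_ord_recr /= -addrA.
congr (_ + _).
  rewrite /gauss_coef !pq_binom0 !subn0 binS bin1 exprD !exprMn exprS.
  by rewrite !expr0; ring.
rewrite addrA; congr (_ + _); last first.
  rewrite /bump /= add1n /gauss_coef !pq_binomnn !subnn binS bin1 exprD !exprMn.
  by rewrite exprS !expr0; ring.
rewrite -big_split; apply: eq_bigr => k _ /=; have kn := ltn_ord k.
rewrite /bump /= add1n /gauss_coef subSS pq_pascal //.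
have e : (n - k = (n - k.+1).+1)%N by rewrite subnSK.
rewrite e !binS !bin1 !exprD !exprMn !exprS; ring.
Qed.

(** The rescaling b -> q b comes from binom(j + 1, 2) = binom(j, 2) + j in the
    exponent of q; the exponent of p depends on n - k only, hence is kept. *)
Lemma gauss_absorption n a b (g : nat -> R) :
  \sum_(k < n.+2) [k] * g k * (gauss_coef n.+1 k * a ^+ (n.+1 - k) * b ^+ k) =
  [n.+1] * b *
    \sum_(j < n.+1) g j.+1 * (gauss_coef n j * a ^+ (n - j) * (b * q) ^+ j).
Proof.
rewrite big_ord_recl pq_int0 !mul0r add0r mulr_sumr.
apply: eq_bigr => j _; rewrite /= /bump /= add1n /gauss_coef subSS.
have e := pq_binom_absorption (ltn_ord j : (j <= n)%N).
rewrite binS bin1 exprD exprMn exprS.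
set G := g _; set P := p ^+ _; set Q := q ^+ 'C(_, _); set A := a ^+ _.
transitivity ([j.+1] * pq_binom p q n.+1 j.+1 *
    (G * P * Q * q ^+ j * A * b * b ^+ j)); first by ring.
by rewrite e; ring.
Qed.

Lemma gauss_moment1 n a b :
  \sum_(k < n.+2) [k] * (gauss_coef n.+1 k * a ^+ (n.+1 - k) * b ^+ k) =
  [n.+1] * b * gauss_poly n a (b * q).
Proof.
have := gauss_absorption n a b (fun=> 1); rewrite gauss_binomial => e.
under eq_bigr do rewrite -[[_]]mulr1.
by rewrite e; congr (_ * _); apply: eq_bigr => j _; rewrite mul1r.
Qed.

(** [n] = 0 for n = 0 makes this form of [gauss_moment1] uniform in n, at the
    price of the factor a + b. *)
Lemma gauss_moment1_scaled n a b :
  (a + b) *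
    (\sum_(k < n.+1) [k] * (gauss_coef n k * (a * p) ^+ (n - k) * b ^+ k)) =
  [n] * b * gauss_poly n a b.
Proof.
case: n => [|n]; first by rewrite big_ord1 pq_int0 !mul0r mulr0.
by rewrite gauss_moment1 gauss_polyS; ring.
Qed.

(** One factor [k] is absorbed; the other becomes [j + 1], which is split as
    p^j + q [j] to reach the first moment at the lower order. *)
Lemma gauss_moment2 n a b :
  \sum_(k < n.+2) [k] * (p ^+ (n.+1 - k) * [k]) *
     (gauss_coef n.+1 k * a ^+ (n.+1 - k) * b ^+ k) =
  [n.+1] * b * (p ^+ n * gauss_poly n a (b * q) +
    q * \sum_(j < n.+1)
          [j] * (gauss_coef n j * (a * p) ^+ (n - j) * (b * q) ^+ j)).
Proof.
rewrite (gauss_absorption n a b (fun k => p ^+ (n.+1 - k) * [k])).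
congr (_ * _); rewrite gauss_binomial !mulr_sumr -big_split /=.
apply: eq_bigr => j _; rewrite subSS pq_intS.
have -> : p ^+ n = p ^+ (n - j) * p ^+ j by rewrite -exprD subnK // -ltnS.
by rewrite !exprMn; ring.
Qed.

(** * Moments of the compressed nodes *)

Lemma node_ge0 n k : 0 <= pq_node p q n k.
Proof.
by apply: divr_ge0; rewrite mulr_ge0 ?exprn_ge0 ?pq_int_ge0 ?ltW.
Qed.

Lemma node_compress n k : (k <= n)%N ->
  compress (pq_node p q n k) = p * (p ^+ (n - k) * [k]) / [n.+1].
Proof.
move=> kn; rewrite /compress /pq_node.
have e : [n.+1] = q ^+ k * [n - k + 1] + p ^+ (n - k + 1) * [k].
  by rewrite -pq_intD addn1 addSn subnK.
have nk : [n - k + 1] != 0 by rewrite addn1.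
have qk : q ^+ k != 0 by rewrite expf_neq0 // gt_eqF.
have := pq_int_neq0 n; rewrite e => ne.
by rewrite mulrA -exprS -[(n - k).+1]addn1; field; rewrite nk qk ne.
Qed.

Lemma pq_ellE n x : pq_ell p q n x = gauss_poly n 1 x.
Proof.
rewrite /pq_ell big_mkord; apply: eq_bigr => s _.
by rewrite mul1r [x * _]mulrC.
Qed.

Definition bbh_weight n x k : R := gauss_coef n k * x ^+ k / gauss_poly n 1 x.

Lemma pq_BBHE n f x :
  pq_BBH p q n f x = \sum_(k < n.+1) bbh_weight n x k * f (pq_node p q n k).
Proof.
rewrite /pq_BBH pq_ellE big_mkord mulr_sumr; apply: eq_bigr => k _.
by rewrite /bbh_weight /gauss_coef !bin2 !subn1 !divn2; ring.
Qed.

Lemma bbh_weight_ge0 n x k : 0 <= x -> 0 <= bbh_weight n x k.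
Proof.
move=> x0; apply: divr_ge0; last by rewrite ltW // gauss_poly_gt0.
by rewrite mulr_ge0 ?gauss_coef_ge0 ?exprn_ge0.
Qed.

Lemma bbh_weight_sum n x : 0 <= x -> \sum_(k < n.+1) bbh_weight n x k = 1.
Proof.
move=> x0; rewrite -mulr_suml.
have -> : \sum_(k < n.+1) gauss_coef n k * x ^+ k = gauss_poly n 1 x.
  by rewrite gauss_binomial; apply: eq_bigr => k _; rewrite expr1n mulr1.
by rewrite divff // gt_eqF // gauss_poly_gt0.
Qed.

Lemma bbh_mean n x : 0 <= x ->
  \sum_(k < n.+2) bbh_weight n.+1 x k * compress (pq_node p q n.+1 k) =
  p * [n.+1] / [n.+2] * (x / (1 + x)).
Proof.
move=> x0; have Q0 : gauss_poly n p (x * q) != 0.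
  by rewrite gt_eqF // gauss_poly_gt0 // mulr_ge0 // ltW.
have x1 : 1 + x != 0 by rewrite gt_eqF // ltr_pwDl.
transitivity (p / [n.+2] / gauss_poly n.+1 1 x *
   \sum_(k < n.+2) [k] * (gauss_coef n.+1 k * p ^+ (n.+1 - k) * x ^+ k)).
  rewrite mulr_sumr; apply: eq_bigr => k _.
  by rewrite node_compress -1?ltnS // /bbh_weight; ring.
rewrite gauss_moment1 gauss_polyS mul1r; field.
by rewrite Q0 x1 pq_int_neq0.
Qed.

Lemma bbh_second_moment n x : 0 <= x ->
  \sum_(k < n.+2) bbh_weight n.+1 x k * compress (pq_node p q n.+1 k) ^+ 2 =
  p ^+ n.+2 * [n.+1] / [n.+2] ^+ 2 * (x / (1 + x)) +
  p ^+ 2 * q ^+ 2 * [n.+1] * [n] / [n.+2] ^+ 2 *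
    (x ^+ 2 / ((1 + x) * (p + q * x))).
Proof.
move=> x0; have xq : 0 <= x * q by rewrite mulr_ge0 // ltW.
have Q0 : gauss_poly n p (x * q) != 0 by rewrite gt_eqF // gauss_poly_gt0.
have x1 : 1 + x != 0 by rewrite gt_eqF // ltr_pwDl.
have px : p + x * q != 0 by rewrite gt_eqF // ltr_pwDl.
transitivity (p ^+ 2 / [n.+2] ^+ 2 / gauss_poly n.+1 1 x *
   \sum_(k < n.+2) [k] * (p ^+ (n.+1 - k) * [k]) *
      (gauss_coef n.+1 k * p ^+ (n.+1 - k) * x ^+ k)).
  rewrite mulr_sumr; apply: eq_bigr => k _.
  by rewrite node_compress -1?ltnS // expr_div_n /bbh_weight; ring.
rewrite gauss_moment2 gauss_polyS mul1r.
have := gauss_moment1_scaled n p (x * q).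
set T := \sum_(j < _) _ => hT.
have -> : T = [n] * (x * q) * gauss_poly n p (x * q) / (p + x * q).
  by apply: (mulfI px); rewrite hT; field.
rewrite [q * x]mulrC !exprS; field.
by rewrite px Q0 x1 pq_int_neq0.
Qed.

(** Expanding the square gives the exact value of the left-hand side, which is
    smaller than the right-hand side by p (1 - p) E with E >= 0. *)
Lemma compressed_variance_le n x : p <= 1 -> 0 <= x ->
  \sum_(k < n.+2) bbh_weight n.+1 x k *
     (compress (pq_node p q n.+1 k) - compress x) ^+ 2 <=
  pq_delta p q n.+1 x.
Proof.
move=> p1 x0; have x1 : 0 < 1 + x by rewrite ltr_pwDl.
have px : 0 < p + q * x by rewrite ltr_pwDl // mulr_ge0 // ltW.
pose E := q ^+ 2 * [n.+1] * [n] / [n.+2] ^+ 2 *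
    (x ^+ 2 / ((1 + x) * (p + q * x))).
have E0 : 0 <= E.
  apply: mulr_ge0; apply: divr_ge0; rewrite ?sqr_ge0 //.
    by rewrite mulr_ge0 ?pq_int_ge0 // mulr_ge0 ?sqr_ge0 ?pq_int_ge0.
  by rewrite ltW // mulr_gt0.
apply: (@le_trans _ _ (pq_delta p q n.+1 x - p * (1 - p) * E)); last first.
  by rewrite gerBl mulr_ge0 // mulr_ge0 ?subr_ge0 // ltW.
rewrite le_eqVlt; apply/orP; left; apply/eqP.
transitivity
  (\sum_(k < n.+2) bbh_weight n.+1 x k * compress (pq_node p q n.+1 k) ^+ 2
   - 2 * compress x *
     (\sum_(k < n.+2) bbh_weight n.+1 x k * compress (pq_node p q n.+1 k))
   + compress x ^+ 2 * \sum_(k < n.+2) bbh_weight n.+1 x k).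
  rewrite !mulr_sumr -sumrB -big_split; apply: eq_bigr => k _ /=; ring.
rewrite bbh_second_moment // bbh_mean // bbh_weight_sum //.
rewrite /pq_delta /compress /E !addn1 subn1 /=.
by field; rewrite pq_int_neq0 !gt_eqF.
Qed.

End Gauss.

Theorem theorem2p3 (R : realType) (p q : nat -> R)
    (hpq : forall n : nat, (1 <= n)%N -> [/\ 0 < q n, q n < p n & p n <= 1])
    (p_cvg1 : p @ \oo --> (1 : R)) (q_cvg1 : q @ \oo --> (1 : R))
    (omega : R -> R) (homega : modulus_of_continuity omega)
    (n : nat) (hn : (1 <= n)%N) (x : R) (hx : 0 <= x)
    (f : R -> R) (hf : H_space omega f) :
  `|pq_BBH (p n) (q n) n f x - f x|
    <= 2 * omega_tilde f (Num.sqrt (pq_delta (p n) (q n) n x)).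
Proof.
have [q0 qp p1] := hpq n hn; rewrite pq_BBHE //.
apply: (weighted_mean_le homega hf hx).
- by move=> k; exact: node_ge0.
- by move=> k; exact: bbh_weight_ge0.
- exact: bbh_weight_sum.
- by case: n hn q0 qp p1 => // n _ q0 qp p1; exact: compressed_variance_le.
Qed.
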